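(* For every integer $p\geq 3$ there exists a $(p,p)$-form $\alpha$ in $\mathbb C^{2p}$ such that $\alpha\geq 0$ but $\alpha^2<0$, i.e. $\alpha\wedge\alpha=c\,dV$ with $c<0$, where $dV=idz_1\wedge d\bar z_1\wedge\dots\wedge idz_{2p}\wedge d\bar z_{2p}$.
   Context: Forms are constant-coefficient forms on $\mathbb C^n$. A $(p,p)$-form $\alpha$ in $\mathbb C^n$ is called positive (written $\alpha\geq 0$) if for all $(1,0)$-forms $\gamma_1,\dots,\gamma_{n-p}\in(\mathbb C^n)^\ast$ one has $\alpha\wedge i\gamma_1\wedge\bar\gamma_1\wedge\dots\wedge i\gamma_{n-p}\wedge\bar\gamma_{n-p}\geq 0$, meaning this $(n,n)$-form is a nonnegative real multiple of the standard volume form $idz_1\wedge d\bar z_1\wedge\dots\wedge idz_n\wedge d\bar z_n$. *)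

(* Defs.v *)
(* Constant-coefficient differential forms on C^n. *)
From HB Require Import structures.
From mathcomp Require Import all_boot all_order all_algebra.
From mathcomp Require Import complex.
From mathcomp Require Import reals.
Set Implicit Arguments. Unset Strict Implicit. Unset Printing Implicit Defensive.
Import Order.TTheory GRing.Theory Num.Theory.
Local Open Scope ring_scope.

Section Forms.
Variable C : numClosedFieldType.
Variable n : nat.

(* Generators of the exterior algebra of (C^n)^* ⊗ C : index k < n stands
   for dz_(k+1), index n + k stands for d\bar z_(k+1); the basis form
   attached to a set S of generators is the wedge of its elements taken in
   increasing index order. *)
Definition gen := 'I_(n + n).
Definition dz_idx (j : 'I_n) : gen := lshift n j.
Definition dzb_idx (j : 'I_n) : gen := rshift n j.

(* A constant-coefficient form = its coefficients on the basis e_S. *)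
Definition cform := {ffun {set gen} -> C}.

Definition fzero : cform := [ffun _ => 0].
Definition fone : cform := [ffun S => if S == set0 then 1 else 0].
Definition fadd (a b : cform) : cform := [ffun S => a S + b S].
Definition fscale (c : C) (a : cform) : cform := [ffun S => c * a S].

(* e_S /\ e_T = sgn S T e_(S u T) when S, T are disjoint, 0 otherwise. *)
Definition inv_count (S T : {set gen}) : nat :=
  #|[set st : gen * gen | (st.1 \in S) && (st.2 \in T) && (st.2 < st.1)%N]|.
Definition sgn (S T : {set gen}) : C := (-1) ^+ inv_count S T.

Definition wedge (a b : cform) : cform :=
  [ffun U => \sum_(S : {set gen}) \sum_(T : {set gen})
      (if [disjoint S & T] && (S :|: T == U) then sgn S T * a S * b T else 0)].

Definition basis1 (k : gen) : cform := [ffun S => if S == [set k] then 1 else 0].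
Definition dz (j : 'I_n) : cform := basis1 (dz_idx j).
Definition dzb (j : 'I_n) : cform := basis1 (dzb_idx j).

(* (p,q)-forms: supported on basis sets with p holomorphic and q
   antiholomorphic generators. *)
Definition is_pq_form (p q : nat) (a : cform) : Prop :=
  forall S : {set gen}, a S != 0 ->
    #|[set j : 'I_n | dz_idx j \in S]| = p /\ #|[set j : 'I_n | dzb_idx j \in S]| = q.

(* (1,0)-cform gamma = sum_j c_j dz_j and its conjugate sum_j c_j^* d\bar z_j *)
Definition form10 (c : 'I_n -> C) : cform := \big[fadd/fzero]_(j < n) fscale (c j) (dz j).
Definition form01conj (c : 'I_n -> C) : cform :=
  \big[fadd/fzero]_(j < n) fscale ((c j)^*) (dzb j).

(* i gamma /\ \bar gamma *)
Definition igg (c : 'I_n -> C) : cform := fscale 'i (wedge (form10 c) (form01conj c)).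

(* dV = i dz_1 /\ d\bar z_1 /\ ... /\ i dz_n /\ d\bar z_n *)
Definition dV : cform := \big[wedge/fone]_(j < n) fscale 'i (wedge (dz j) (dzb j)).

(* An (n,n)-cform is >= 0 iff it is a nonnegative real multiple of dV. *)
Definition nn_nonneg (w : cform) : Prop := exists c : C, 0 <= c /\ w = fscale c dV.

(* Positivity of a (p,p)-cform (definition in the paper). *)
Definition positive_form (p : nat) (a : cform) : Prop :=
  forall gam : 'I_(n - p) -> 'I_n -> C,
    nn_nonneg (wedge a (\big[wedge/fone]_(k < n - p) igg (gam k))).

End Forms.

(* Main.v *)
Require Import Defs.
From HB Require Import structures.
From mathcomp Require Import all_boot all_order all_algebra.
From mathcomp Require Import complex.
From mathcomp Require Import reals.
From mathcomp Require Import boolp ring zify.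
Import Order.TTheory GRing.Theory Num.Theory.
Local Open Scope ring_scope.
Set Implicit Arguments. Unset Strict Implicit. Unset Printing Implicit Defensive.

(* A (p,p)-form on C^2p is a sesquilinear form in the minors D_J of the matrix
   with rows gamma_1, .., gamma_p; it is positive when its values on these are
   nonnegative. For p = 3 put P = D_012, Q = D_345, and let A_ij, B_ij be the
   minors obtained by exchanging the i-th index of 012 with the j-th of 345.
   The Pluecker relations P Q = sum_j A_ij B_ij, one for each i, give
   3 |P Q| <= sum_ij |A_ij| |B_ij|, hence
     12 Re (P Q^* ) + 3 |P|^2 + 3 |Q|^2 + sum_ij (|A_ij|^2 + |B_ij|^2) >= 0.
   In the square of the corresponding form the diagonal terms contribute
   9 * 2 + 18 = 36, while the two off-diagonal ones contribute -36 each,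
   because exchanging two blocks of three indices is an odd permutation.
   For p = 3 + q this form is multiplied by w^W + w^W', with w_k = i dz_k dzb_k
   and W, W' the two halves of the remaining 2q indices. *)

(** * Anticommuting elements of an algebra *)

(* Insertion sort with the sign of the permutation, 0 if an index is repeated. *)
Fixpoint sign_insert (x : nat) (s : seq nat) : int * seq nat :=
  if s is y :: s' then
    if (x < y)%N then (1, x :: s) else
    if x == y then (0, s) else
    let: (c, t) := sign_insert x s' in (- c, y :: t)
  else (1, [:: x]).

Fixpoint sign_sort (s : seq nat) : int * seq nat :=
  if s is x :: s' then
    let: (c, t) := sign_sort s' in
    let: (d, t') := sign_insert x t in (c * d, t')
  else (1, [::]).

Section AnticommutingElements.
Variables (F : comNzRingType) (A : algType F) (P : A -> Prop).
Hypothesis anti : forall x y, P x -> P y -> x * y = - (y * x).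
Hypothesis sqr0 : forall x, P x -> x * x = 0.

(** [z] and [t] each cross both [x] and [y], so the signs cancel. *)
Lemma anti_pair_comm x y z t : P x -> P y -> P z -> P t ->
  GRing.comm (x * y) (z * t).
Proof.
move=> Px Py Pz Pt; rewrite /GRing.comm -!mulrA [y * (z * t)]mulrA (anti Py Pz).
rewrite mulNr mulrN -mulrA (anti Py Pt) !mulrN opprK !mulrA (anti Px Pz) !mulNr.
by rewrite -[z * x * t]mulrA (anti Px Pt) mulrN mulNr opprK !mulrA.
Qed.

Lemma anti_pair_sqr0 x y : P x -> P y -> (x * y) * (x * y) = 0.
Proof.
by move=> Px Py; rewrite mulrA (anti Px Py) mulNr -mulrA sqr0 // mulr0 oppr0 mul0r.
Qed.

Lemma anti_prod x I (s : seq I) (y : I -> A) : P x -> (forall i, P (y i)) ->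
  x * (\prod_(i <- s) y i) = (-1) ^+ size s *: ((\prod_(i <- s) y i) * x).
Proof.
move=> Px Py; elim: s => [|i s IH]; first by rewrite big_nil mulr1 mul1r scale1r.
rewrite big_cons mulrA (anti Px (Py i)) mulNr -[X in - X]mulrA IH -scalerAr exprS mulN1r scaleNr.
by rewrite -mulrA.
Qed.

(** Each [y i] crosses the [x] factors that follow it. The resulting scalar depends only on [c] and
    the length and is left unevaluated, since it is only compared with itself. *)
Lemma prod_pairs c I (s : seq I) (x y : I -> A) :
  (forall i, P (x i)) -> (forall i, P (y i)) ->
  \prod_(i <- s) (c *: (x i * y i)) =
  (\prod_(j < size s) (c * (-1) ^+ j)) *: ((\prod_(i <- s) x i) * \prod_(i <- s) y i).
Proof.
move=> Px Py; elim: s => [|i s IH]; first by rewrite !big_nil big_ord0 mulr1 scale1r.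
rewrite !big_cons IH -scalerAl -scalerAr scalerA big_ord_recr /=.
rewrite -!mulrA [y i * (_ * _)]mulrA (anti_prod _ (Py i) Px) -scalerAl -scalerAr scalerA.
by rewrite !mulrA; congr (_ *: _); ring.
Qed.

(** The sign counts the [j] factors that [g j] crosses; it is the sign of a cofactor along the first
    row. *)
Lemma prod_lift n (g : 'I_n.+1 -> A) (j : 'I_n.+1) : (forall i, P (g i)) ->
  g j * \prod_(k < n) g (lift j k) = (-1) ^+ j *: \prod_(k < n.+1) g k.
Proof.
elim: n g j => [|n IH] g j Pg.
  by rewrite ord1 big_ord_recl !big_ord0 scale1r.
have [j' ->|->] := unliftP ord0 j; last by rewrite [in RHS]big_ord_recl scale1r.
rewrite big_ord_recl (_ : lift (lift ord0 j') ord0 = ord0); last exact: val_inj.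
rewrite mulrA (anti (Pg _) (Pg ord0)) mulNr -[X in - X]mulrA.
rewrite (eq_bigr (fun k => g (lift ord0 (lift j' k)))); last first.
  move=> k _; congr g; apply: val_inj => /=; rewrite /bump /=.
  by rewrite !add1n !ltnS addnS.
rewrite (IH (fun k => g (lift ord0 k)) j') // [in RHS]big_ord_recl lift0 exprS mulN1r.
by rewrite scaleNr -scalerAr.
Qed.

(** With [x] in front, any multiple of [x] in a later factor dies because [x * x = 0]. *)
Lemma mul_prod_shift x I (s : seq I) (u : I -> A) (c : I -> F) :
  P x -> (forall i, P (u i)) ->
  x * (\prod_(i <- s) (u i + c i *: x)) = x * \prod_(i <- s) u i.
Proof.
move=> Px Pu; elim: s => [|i s IH]; first by rewrite !big_nil.
rewrite !big_cons !mulrA mulrDr -scalerAr sqr0 // scaler0 addr0.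
by rewrite (anti Px (Pu i)) !mulNr -!mulrA IH.
Qed.

Hypothesis Plin : forall I (s : seq I) (c : I -> F) (u : I -> A),
  (forall i, P (u i)) -> P (\sum_(i <- s) c i *: u i).

(** Laplace expansion along the first row, by induction on [n]. *)
Lemma prod_linear_comb n (g : 'I_n -> A) (M : 'M[F]_n) : (forall i, P (g i)) ->
  \prod_(i < n) (\sum_j M i j *: g j) = \det M *: \prod_(i < n) g i.
Proof.
elim: n g M => [|n IH] g M Pg; first by rewrite !big_ord0 det_mx00 scale1r.
rewrite big_ord_recl mulr_suml (expand_det_row _ ord0) scaler_suml.
apply: eq_bigr => j _.
rewrite -scalerAl /cofactor -scalerA; congr (_ *: _).
rewrite add0n mulrC -scalerA -(prod_lift j Pg) scalerAr -IH //.
(* Behind [g j] the components of the other rows along [g j] are invisible, so they can be added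
   back. *)
rewrite -[RHS](mul_prod_shift _ (fun i => M (lift ord0 i) j)) //; last first.
  by move=> i; apply: Plin.
congr (_ * _); apply: eq_bigr => i _.
rewrite addrC (bigD1_ord j) //=; congr (_ + _).
by apply: eq_bigr => k _; rewrite !mxE.
Qed.

Lemma sign_insertE (e : nat -> A) x s : (forall k, P (e k)) ->
  e x * \prod_(k <- s) e k =
  (sign_insert x s).1%:~R *: \prod_(k <- (sign_insert x s).2) e k.
Proof.
move=> Pe; elim: s => [|y s IH] /=; first by rewrite big_seq1 big_nil mulr1 scale1r.
case: ifP => _; first by rewrite !big_cons mulr1z scale1r.
case: eqP => [->|_]; first by rewrite big_cons mulrA sqr0 // mul0r scale0r.
case: (sign_insert x s) IH => c t /= IH.
rewrite !big_cons mulrA (anti (Pe x) (Pe y)) mulNr -[X in - X]mulrA IH.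
by rewrite -scalerAr mulrNz scaleNr.
Qed.

(** Reordering a product of one-forms becomes a computation on lists of numbers. With a repeated
    index the sign is 0 and both sides vanish. *)
Lemma sign_sortE (e : nat -> A) s : (forall k, P (e k)) ->
  \prod_(k <- s) e k = (sign_sort s).1%:~R *: \prod_(k <- (sign_sort s).2) e k.
Proof.
move=> Pe; elim: s => [|x s IH] /=; first by rewrite mulr1z scale1r.
case: (sign_sort s) IH => c t /= IH; have := sign_insertE x t Pe.
case: (sign_insert x t) => d t' /= E.
by rewrite big_cons IH -scalerAr E scalerA intrM.
Qed.
End AnticommutingElements.

(** * Pluecker relations between determinants *)

Section Pluecker.
Variables (F : comNzRingType) (n : nat).
Definition set_row (M : 'M[F]_n) i (v : 'I_n -> F) : 'M[F]_n :=
  \matrix_(k, j) if k == i then v j else M k j.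

(** The cofactors along row [i] do not see row [i], so replacing that row leaves them unchanged. *)
Lemma det_set_row M i v : \det (set_row M i v) = \sum_j v j * cofactor M i j.
Proof.
rewrite (expand_det_row _ i); apply: eq_bigr => j _; rewrite mxE eqxx; congr (_ * _).
rewrite /cofactor; congr (_ * \det _); apply/matrixP => k l; rewrite !mxE.
by rewrite eq_sym (negPf (neq_lift _ _)).
Qed.

(* Cramer's rule writes [\det N] times the exchanged row as a combination of the rows of [N]. *)
Lemma pluecker_exchange (M N : 'M[F]_n) i :
  \det M * \det N =
  \sum_k \det (set_row M i (N k)) * \det (set_row N k (M i)).
Proof.
under eq_bigr do rewrite !det_set_row mulr_suml.
rewrite exchange_big (expand_det_row M i) mulr_suml; apply: eq_bigr => j _ /=.
under eq_bigr do rewrite mulr_sumr.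
rewrite exchange_big /= (bigD1 j) //= [X in _ + X]big1 ?addr0 => [|l lj].
  rewrite (expand_det_col N j) mulr_sumr; apply: eq_bigr => k _; ring.
(* For [l != j] the terms assemble into an off-diagonal entry of [\adj N *m N], which is 0. *)
have /matrixP/(_ l j) := mul_adj_mx N; rewrite !mxE (negPf lj) mulr0n => E.
transitivity (M i l * cofactor M i j * \sum_k (\adj N) l k * N k j); last by rewrite E mulr0.
by rewrite mulr_sumr; apply: eq_bigr => k _; rewrite mxE; ring.
Qed.
End Pluecker.

(** * The exterior algebra *)

Section ExteriorRing.
Variables (C : numClosedFieldType) (n : nat).
Implicit Types (a b c : cform C n) (S T U : {set gen n}).

Lemma inv_countUl S T U : [disjoint S & T] ->
  inv_count (S :|: T) U = (inv_count S U + inv_count T U)%N.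
Proof.
move=> dST; rewrite /inv_count -cardsUI [X in (_ = _ + X)%N]eq_card0.
  by rewrite addn0; apply: eq_card => -[s t]; rewrite !inE /= andb_orl andb_orl.
move=> [s t]; rewrite !inE /=; apply/negP => /andP[/andP[/andP[sS _] _]].
by case/andP=> /andP[sT _] _; move: (disjointFr dST sS); rewrite sT.
Qed.

Lemma inv_countUr S T U : [disjoint T & U] ->
  inv_count S (T :|: U) = (inv_count S T + inv_count S U)%N.
Proof.
move=> dTU; rewrite /inv_count -cardsUI [X in (_ = _ + X)%N]eq_card0.
  by rewrite addn0; apply: eq_card => -[s t]; rewrite !inE /= andb_orr andb_orl.
move=> [s t]; rewrite !inE /=; apply/negP => /andP[/andP[/andP[_ tT] _]].
by case/andP=> /andP[_ tU] _; move: (disjointFr dTU tT); rewrite tU.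
Qed.

Lemma sgn_swap1 (k l : gen n) : k != l ->
  sgn C [set k] [set l] = - sgn C [set l] [set k].
Proof.
have E (x y : gen n) : inv_count [set x] [set y] = (y < x)%N.
  rewrite /inv_count; case: (ltnP y x) => yx.
    rewrite (_ : finset _ = [set (x, y)]) ?cards1 //.
    apply/setP => -[s t]; rewrite !inE /= xpair_eqE.
    by case: eqP => [->|//]; case: eqP => [->|//]; rewrite yx.
  rewrite (_ : finset _ = set0) ?cards0 //.
  apply/setP => -[s t]; rewrite !inE /=.
  by case: eqP => [->|//]; case: eqP => [->|//]; rewrite ltnNge yx.
move=> kl; rewrite /sgn !E; have: (k : nat) != l by [].
by case: ltngtP => //= _ _; rewrite expr0 expr1 ?opprK.
Qed.

(** The condition becomes a multiplicity 0 or 1, which moves through sums without case splits. *)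
Lemma wedgeE a b U : wedge a b U =
  \sum_S \sum_T (sgn C S T * a S * b T) *+ ([disjoint S & T] && (S :|: T == U)).
Proof.
rewrite ffunE; apply: eq_bigr => S _; apply: eq_bigr => T _.
by case: ifP; rewrite (mulr1n, mulr0n).
Qed.

(** Both bracketings are the sum over triples of pairwise disjoint sets with the product of the
    three pairwise signs, because inversion counts are additive over disjoint unions in either
    argument. *)
Lemma wedgeA : associative (@wedge C n).
Proof.
move=> a b c; apply/ffunP => U.
transitivity (\sum_S \sum_T \sum_V
  (sgn C S T * sgn C S V * sgn C T V * (a S * b T * c V)) *+
  [&& [disjoint S & T], [disjoint S & V], [disjoint T & V] & S :|: T :|: V == U]).
  rewrite wedgeE; apply: eq_bigr => S _.
  transitivity (\sum_X \sum_T \sum_V (sgn C S X * a S * (sgn C T V * b T * c V))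
     *+ ([disjoint S & X] && (S :|: X == U)) *+ ([disjoint T & V] && (T :|: V == X))).
    apply: eq_bigr => X _; rewrite wedgeE mulr_sumr -sumrMnl; apply: eq_bigr => T _.
    rewrite mulr_sumr -sumrMnl; apply: eq_bigr => V _.
    by rewrite mulrnAr mulrnAC.
  rewrite exchange_big; apply: eq_bigr => T _.
  rewrite exchange_big; apply: eq_bigr => V _ /=.
  rewrite (bigD1 (T :|: V)) //= big1 ?addr0; last first.
    by move=> X /negPf nX; rewrite [T :|: V == X]eq_sym nX andbF mulr0n.
  rewrite eqxx andbT setUA; case dTV: [disjoint T & V]; last first.
    by rewrite /= !andbF !mulr0n.
  rewrite /sgn inv_countUr // exprD mulr1n -!setI_eq0 setIUr setU_eq0 -andbA /=.
  by congr (_ *+ _); ring.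
rewrite wedgeE.
transitivity (\sum_X \sum_S \sum_T \sum_V (sgn C X V * (sgn C S T * a S * b T) * c V)
     *+ ([disjoint X & V] && (X :|: V == U)) *+ ([disjoint S & T] && (S :|: T == X))).
  rewrite [RHS]exchange_big; apply: eq_bigr => S _.
  rewrite [RHS]exchange_big; apply: eq_bigr => T _.
  rewrite [RHS]exchange_big; apply: eq_bigr => V _ /=.
  rewrite (bigD1 (S :|: T)) //= big1 ?addr0; last first.
    by move=> X /negPf nX; rewrite [S :|: T == X]eq_sym nX andbF mulr0n.
  rewrite eqxx andbT; case dST: [disjoint S & T]; last by rewrite /= !mulr0n.
  rewrite /sgn inv_countUl // exprD mulr1n -!setI_eq0 setIUl setU_eq0 -andbA /=.
  by congr (_ *+ _); ring.
apply: eq_bigr => X _.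
transitivity (\sum_S \sum_V \sum_T (sgn C X V * (sgn C S T * a S * b T) * c V)
     *+ ([disjoint X & V] && (X :|: V == U)) *+ ([disjoint S & T] && (S :|: T == X))).
  by apply: eq_bigr => S _; rewrite exchange_big.
rewrite exchange_big; apply: eq_bigr => V _ /=.
rewrite wedgeE mulr_sumr mulr_suml -sumrMnl; apply: eq_bigr => S _.
rewrite mulr_sumr mulr_suml -sumrMnl; apply: eq_bigr => T _.
by rewrite mulrnAr mulrnAl mulrnAC.
Qed.

Lemma inv_count0l T : inv_count (@set0 (gen n)) T = 0%N.
Proof. by apply: eq_card0 => st; rewrite !inE. Qed.

Lemma inv_count0r S : inv_count S (@set0 (gen n)) = 0%N.
Proof. by apply: eq_card0 => st; rewrite !inE andbF. Qed.

Lemma wedge1l : left_id (fone C n) (@wedge C n).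
Proof.
move=> a; apply/ffunP => U; rewrite wedgeE (bigD1 set0) //= [X in _ + X]big1 ?addr0.
  rewrite (bigD1 U) //= [X in _ + X]big1 ?addr0 => [|T /negPf TU].
    by rewrite ffunE eqxx set0U eqxx -setI_eq0 set0I eqxx /sgn inv_count0l !mul1r.
  by rewrite set0U TU andbF.
by move=> S /negPf S0; rewrite big1 // => T _; rewrite ffunE S0 mulr0 mul0r mul0rn.
Qed.

Lemma wedge1r : right_id (fone C n) (@wedge C n).
Proof.
move=> a; apply/ffunP => U; rewrite wedgeE (bigD1 U) //= [X in _ + X]big1 ?addr0.
  rewrite (bigD1 set0) //= [X in _ + X]big1 ?addr0 => [|T /negPf T0].
    by rewrite ffunE eqxx setU0 eqxx -setI_eq0 setI0 eqxx /sgn inv_count0r mul1r mulr1.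
  by rewrite ffunE T0 mulr0 mul0rn.
move=> S /negPf SU; rewrite big1 // => T _; rewrite ffunE.
by case: (altP (T =P set0)) => [->|_]; rewrite ?setU0 ?SU ?andbF // mulr0 mul0rn.
Qed.

Lemma wedgeDl : left_distributive (@wedge C n) (@fadd C n).
Proof.
move=> a b c; apply/ffunP => U; rewrite [RHS]ffunE !wedgeE -big_split; apply: eq_bigr => S _ /=.
by rewrite -big_split; apply: eq_bigr => T _ /=; rewrite ffunE mulrDr mulrDl mulrnDl.
Qed.

Lemma wedgeDr : right_distributive (@wedge C n) (@fadd C n).
Proof.
move=> a b c; apply/ffunP => U; rewrite [RHS]ffunE !wedgeE -big_split; apply: eq_bigr => S _ /=.
by rewrite -big_split; apply: eq_bigr => T _ /=; rewrite ffunE mulrDr mulrnDl.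
Qed.

Lemma wedgeZl x a b : fscale x (wedge a b) = wedge (fscale x a) b.
Proof.
apply/ffunP => U; rewrite ffunE !wedgeE mulr_sumr; apply: eq_bigr => S _ /=.
rewrite mulr_sumr; apply: eq_bigr => T _ /=; rewrite ffunE mulrnAr.
by congr (_ *+ _); ring.
Qed.

Lemma wedgeZr x a b : fscale x (wedge a b) = wedge a (fscale x b).
Proof.
apply/ffunP => U; rewrite ffunE !wedgeE mulr_sumr; apply: eq_bigr => S _ /=.
rewrite mulr_sumr; apply: eq_bigr => T _ /=; rewrite ffunE mulrnAr.
by congr (_ *+ _); ring.
Qed.

Lemma fone_neq0 : fone C n != 0 :> {ffun {set gen n} -> C^o}.
Proof. by apply/eqP => /ffunP/(_ set0)/eqP; rewrite !ffunE eqxx oner_eq0. Qed.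
End ExteriorRing.

(* An alias is needed because the finfun type already carries the pointwise product. *)
Definition ext (C : numClosedFieldType) (n : nat) : Type := cform C n.

Section Instances.
Variables (C : numClosedFieldType) (n : nat).
HB.instance Definition _ := GRing.Lmodule.copy (ext C n) {ffun {set gen n} -> C^o}.
HB.instance Definition _ := GRing.Zmodule_isNzRing.Build (ext C n)
  (@wedgeA C n) (@wedge1l C n) (@wedge1r C n) (@wedgeDl C n) (@wedgeDr C n) (fone_neq0 C n).
HB.instance Definition _ := GRing.Lmodule_isLalgebra.Build C (ext C n) (@wedgeZl C n).
HB.instance Definition _ := GRing.Lalgebra_isAlgebra.Build C (ext C n) (@wedgeZr C n).
End Instances.

(** * Products of one-forms *)

Section OneForms.
Variables (C : numClosedFieldType) (n : nat).
Local Notation E := (ext C n).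
Local Notation V := ('I_n -> C).
Implicit Types (a b : E) (u v : V) (L : seq V).

(** Degree one in all [2n] generators: the [dz] and the [dzb] are treated together, as they also
    anticommute with each other. *)
Definition one_form (a : E) : Prop := forall S, (a : cform C n) S != 0 -> #|S| = 1%N.

Lemma one_form_anti a b : one_form a -> one_form b -> a * b = - (b * a).
Proof.
move=> a1 b1; apply/ffunP => U; rewrite [RHS]ffunE [LHS]wedgeE [X in - X]wedgeE.
rewrite [in RHS]exchange_big -sumrN; apply: eq_bigr => S _.
rewrite -sumrN; apply: eq_bigr => T _ /=.
rewrite [T :|: S]setUC [[disjoint T & S]]disjoint_sym -mulNrn.
case dST: [disjoint S & T] => //=; congr (_ *+ _).
have [-> | aS] := eqVneq ((a : cform C n) S) 0; first by rewrite !(mulr0, mul0r) oppr0.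
have [-> | bT] := eqVneq ((b : cform C n) T) 0; first by rewrite !(mulr0, mul0r) oppr0.
have /eqP/cards1P[k Sk] := a1 _ aS; have /eqP/cards1P[l Tl] := b1 _ bT.
rewrite Sk Tl sgn_swap1 ?mulNr; first by ring.
by move: dST; rewrite Sk Tl disjoints1 inE.
Qed.

Lemma one_form_sqr0 a : one_form a -> a * a = 0.
Proof.
move=> a1; have /eqP := one_form_anti a1 a1.
rewrite -addr_eq0 -mulr2n -scaler_nat scaler_eq0 => /orP[|/eqP //].
by rewrite pnatr_eq0.
Qed.

Lemma one_form_sum I (s : seq I) (c : I -> C) (f : I -> E) :
  (forall i, one_form (f i)) -> one_form (\sum_(i <- s) c i *: f i).
Proof.
move=> f1; elim: s => [|i s IH] S; first by rewrite big_nil ffunE eqxx.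
rewrite big_cons ffunE; have [fS|fS _] := eqVneq ((f i : cform C n) S) 0.
  by rewrite [X in X + _]ffunE fS scaler0 add0r => /IH.
exact: f1 fS.
Qed.

Lemma one_form_basis1 k : one_form (basis1 C k).
Proof.
by move=> S; rewrite ffunE; case: (altP (S =P _)) => [->|]; rewrite ?cards1 // eqxx.
Qed.

(** Holds by conversion, the operations of [ext] being [fadd], [fscale] and [wedge]. *)
Lemma form10E u : form10 u = \sum_j u j *: (dz C j : E). Proof. by []. Qed.
Lemma form01conjE u : form01conj u = \sum_j (u j)^* *: (dzb C j : E). Proof. by []. Qed.

Lemma one_form10 u : one_form (form10 u).
Proof. by rewrite form10E; apply: one_form_sum => j; apply: one_form_basis1. Qed.
Lemma one_form01 u : one_form (form01conj u).
Proof. by rewrite form01conjE; apply: one_form_sum => j; apply: one_form_basis1. Qed.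

(** The polarization of [igg]: by conversion, [hform u u] is [igg u]. *)
Definition hform u v : E := 'i *: ((form10 u : E) * (form01conj v : E)).

Lemma hform_comm u v u' v' : GRing.comm (hform u v) (hform u' v').
Proof.
rewrite /GRing.comm /hform -!scalerAl -!scalerAr; congr (_ *: (_ *: _)).
apply: (anti_pair_comm one_form_anti).
- exact: one_form10.
- exact: one_form01.
- exact: one_form10.
- exact: one_form01.
Qed.

Lemma hform_sqr0 u v : hform u v * hform u v = 0.
Proof.
rewrite /hform -!scalerAl -!scalerAr (anti_pair_sqr0 one_form_anti one_form_sqr0).
- by rewrite !scaler0.
- exact: one_form10.
- exact: one_form01.
Qed.

(** Vectors are kept in lists so that families can be joined by [++]; missing rows are zero. *)
Definition rows L : 'M[C]_n := \matrix_(i, j) nth (fun=> 0) L i j.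
Definition vecdet L : C := \det (rows L).

Lemma prod_form10 L : size L = n ->
  \prod_(u <- L) (form10 u : E) = vecdet L *: \prod_(j < n) (dz C j : E).
Proof.
move=> sL; rewrite (big_nth (fun=> 0)) sL big_mkord.
rewrite -(prod_linear_comb one_form_anti one_form_sqr0 one_form_sum); last first.
  by move=> i; apply: one_form_basis1.
by apply: eq_bigr => i _; rewrite form10E; apply: eq_bigr => j _; rewrite mxE.
Qed.

Lemma prod_form01conj L : size L = n ->
  \prod_(u <- L) (form01conj u : E) = (vecdet L)^* *: \prod_(j < n) (dzb C j : E).
Proof.
move=> sL; rewrite (big_nth (fun=> 0)) sL big_mkord -det_map_mx.
rewrite -(prod_linear_comb one_form_anti one_form_sqr0 one_form_sum); last first.
  by move=> i; apply: one_form_basis1.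
by apply: eq_bigr => i _; rewrite form01conjE; apply: eq_bigr => j _; rewrite !mxE.
Qed.

(** Separating the holomorphic factors from the others costs the same scalar here and in [dV], so
    only the two determinants remain. *)
Lemma prod_hform (s : seq (V * V)) : size s = n ->
  \prod_(x <- s) hform x.1 x.2 =
  (vecdet (unzip1 s) * (vecdet (unzip2 s))^*) *: (dV C n : E).
Proof.
move=> ss.
rewrite (prod_pairs one_form_anti) => [|x|x]; [|exact: one_form10|exact: one_form01].
rewrite -(big_map fst xpredT (fun u => form10 u : E)).
rewrite -(big_map snd xpredT (fun u => form01conj u : E)).
rewrite prod_form10 ?size_map // prod_form01conj ?size_map //.
rewrite -scalerAl -scalerAr !scalerA.
have -> : (dV C n : E) = \prod_(j < n) ('i *: ((dz C j : E) * (dzb C j : E))) by [].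
rewrite (prod_pairs one_form_anti) => [|x|x]; [|exact: one_form_basis1..].
have sz : size (index_enum 'I_n) = n by rewrite -[index_enum _]enumT size_enum_ord.
rewrite scalerA ss sz. congr (_ *: _).
by rewrite [RHS]mulrC mulrA.
Qed.

(** Pluecker relation with the rows of [L] held fixed. Exchanging with a row of [L] would repeat
    that row, so only the rows of [t] enter the sum. *)
Lemma vecdet_exchange s t L i : size s = size t -> (size s + size L)%N = n ->
  (i < size s)%N ->
  vecdet (s ++ L) * vecdet (t ++ L) = \sum_(k < size t)
    vecdet (set_nth (fun=> 0) s i (nth (fun=> 0) t k) ++ L) *
    vecdet (set_nth (fun=> 0) t k (nth (fun=> 0) s i) ++ L).
Proof.
move=> st sn lti; have ltin : (i < n)%N by lia.
rewrite {1 2}/vecdet (pluecker_exchange _ _ (Ordinal ltin)).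
pose G k := vecdet (set_nth (fun=> 0) s i (nth (fun=> 0) t k) ++ L) *
    vecdet (set_nth (fun=> 0) t k (nth (fun=> 0) s i) ++ L).
have le : (size t <= n)%N by lia.
rewrite (big_ord_widen n G le) [RHS]big_mkcond; apply: eq_bigr => k _.
have setE r l v (l' : 'I_n) v' : (l < size r)%N -> l = l' -> v =1 v' ->
    rows (set_nth (fun=> 0) r l v ++ L) = set_row (rows (r ++ L)) l' v'.
  move=> lr ll' vv'; apply/matrixP => a b; rewrite !mxE !nth_cat size_set_nth.
  rewrite (maxn_idPr lr) nth_set_nth /= -(inj_eq val_inj) /= -ll'.
  by case: (altP eqP) => [->|_]; [rewrite lr vv' | case: ifP].
case: ltnP => kt; last first.
  rewrite (_ : \det (set_row (rows (s ++ L)) _ _) = 0) ?mul0r //.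
  apply: (@determinant_alternate _ _ _ (Ordinal ltin) k).
    by rewrite -(inj_eq val_inj) /=; lia.
  move=> j; rewrite !mxE eqxx !nth_cat -(inj_eq val_inj) /= st.
  by rewrite ltnNge kt /=; case: eqP => // ki; move: lti; rewrite -ki st ltnNge kt.
rewrite /G /vecdet; congr (_ * _); congr (\det _); symmetry; apply: setE => // j;
by rewrite mxE nth_cat ?kt ?lti.
Qed.
End OneForms.

(** * The form *)

Section Inequality.
Variable C : numClosedFieldType.
Implicit Types x y : C.

Lemma norm_AGM2 x y : (`|x| * `|y|) *+ 2 <= x * x^* + y * y^*.
Proof.
rewrite -!normCK -subr_ge0 addrAC -sqrrB real_exprn_even_ge0 //.
by rewrite rpredB // normr_real.
Qed.

Lemma herm_norm_ge x y : - ((`|x| * `|y|) *+ 2) <= x * y^* + y * x^*.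
Proof.
have -> : y * x^* = (x * y^*)^* by rewrite rmorphM /= conjCK mulrC.
have -> : `|x| * `|y| = `|x * y^*| by rewrite normrM norm_conjC.
apply: real_lerNnormlW; first by rewrite CrealE rmorphD /= conjCK addrC.
by rewrite (le_trans (ler_normD _ _)) // norm_conjC mulr2n.
Qed.

Lemma example_herm_ge0 (a b : C) (A B : nat -> nat -> C) r :
  size r = 3%N -> (forall i, i \in r -> a * b = \sum_(j <- r) A i j * B i j) ->
  0 <= 6 * (a * b^*) + 6 * (b * a^*) + 3 * (a * a^*) + 3 * (b * b^*) +
    \sum_(i <- r) \sum_(j <- r) (A i j * (A i j)^* + B i j * (B i j)^*).
Proof.
move=> r3 abE; set S := \sum_(i <- r) _; set N := `|a| * `|b|.
(* Each of the three relations yields [2 N], and the three are added. *)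
have NS : N *+ 6 <= S.
  have -> : N *+ 6 = \sum_(i <- r) N *+ 2.
    by rewrite big_const_seq count_predT r3 /= addr0 -!mulrnDr.
  rewrite big_seq [S]big_seq; apply: ler_sum => i ir.
  apply: le_trans (_ : (\sum_(j <- r) `|A i j| * `|B i j|) *+ 2 <= _).
    rewrite lerMn2r /N -normrM (abE i ir) (le_trans (ler_norm_sum _ _ _)) //.
    by apply: ler_sum => j _; rewrite normrM.
  by rewrite -sumrMnl; apply: ler_sum => j _; apply: norm_AGM2.
have -> : 6 * (a * b^*) + 6 * (b * a^*) + 3 * (a * a^*) + 3 * (b * b^*) + S =
    6 * (a * b^* + b * a^*) + 3 * (a * a^* + b * b^*) + S by ring.
(* The balance: at least [-12 N] from the cross terms, [6 N] from [3 |a|^2 + 3 |b|^2] and [6 N] from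
   [S]. *)
have -> : 0 = 6 * - (N *+ 2) + 3 * (N *+ 2) + N *+ 6 by ring.
rewrite lerD // lerD // ler_wpM2l ?ler0n //; first exact: herm_norm_ge.
exact: norm_AGM2.
Qed.
End Inequality.

(** * The terms of the form for p = 3, as integer data *)

Definition triP : seq nat := [:: 0; 1; 2]%N.
Definition triQ : seq nat := [:: 3; 4; 5]%N.
(** Indices are exchanged in place and left unsorted, as in [vecdet_exchange], so the relations
    carry no extra signs. *)
Definition triA i j := set_nth 0%N triP i (nth 0%N triQ j).
Definition triB i j := set_nth 0%N triQ j (nth 0%N triP i).
(** An entry [(c, (I, J))] encodes [c] times [mono I J], whose value on test vectors is
    [c D_I D_J^*]. The two entries with 6 make up 12 times the real part of [P Q^*]. *)
Definition herm_terms : seq (int * (seq nat * seq nat)) :=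
  [:: (6%:Z, (triP, triQ)); (6%:Z, (triQ, triP)); (3%:Z, (triP, triP)); (3%:Z, (triQ, triQ))]
  ++ [seq (1%:Z, (triA i j, triA i j)) | i <- iota 0 3, j <- iota 0 3]
  ++ [seq (1%:Z, (triB i j, triB i j)) | i <- iota 0 3, j <- iota 0 3].

(* Sign of the product of two terms relative to dz_0 .. dz_5 and dzb_0 .. dzb_5. *)
Definition pair_sign (x y : int * (seq nat * seq nat)) : int :=
  (sign_sort (x.2.1 ++ y.2.1)).1 * (sign_sort (x.2.2 ++ y.2.2)).1.

Lemma herm_terms_size : all (fun x => (size x.2.1 == 3) && (size x.2.2 == 3)) herm_terms.
Proof. by vm_compute. Qed.

(** Supplies the hypothesis of [mono_sort] for every product of two terms. *)
Lemma herm_terms_sorted : all (fun x => all (fun y =>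
  (pair_sign x y == 0) || ((sign_sort (x.2.1 ++ y.2.1)).2 == iota 0 6)
    && ((sign_sort (x.2.2 ++ y.2.2)).2 == iota 0 6)) herm_terms) herm_terms.
Proof. by vm_compute. Qed.

Lemma herm_terms_square :
  \sum_(x <- herm_terms) \sum_(y <- herm_terms) x.1 * y.1 * pair_sign x y = (-36)%:~R :> int.
Proof. by rewrite unlock; vm_compute. Qed.

Lemma herm_terms_sum (C : comNzRingType) (f : int * (seq nat * seq nat) -> C) :
  \sum_(x <- herm_terms) f x =
  f (6%:Z, (triP, triQ)) + f (6%:Z, (triQ, triP)) +
  f (3%:Z, (triP, triP)) + f (3%:Z, (triQ, triQ)) +
  \sum_(i <- iota 0 3) \sum_(j <- iota 0 3)
    (f (1%:Z, (triA i j, triA i j)) + f (1%:Z, (triB i j, triB i j))).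
Proof. by rewrite /herm_terms /= !big_cons !big_nil; ring. Qed.

(** * Monomials; the form in dimension 2p, its square and its positivity *)

Section Example.
Variables (C : numClosedFieldType) (n : nat).
Local Notation E := (ext C n).
Local Notation V := ('I_n -> C).
Implicit Types (s t : seq nat).

(** Indices are natural numbers, as [sign_sort] needs; the vector is 0 when [k >= n]. *)
Definition stdvec (k : nat) : V := fun j => (k == j :> nat)%:R.
Definition mono s t : E := \prod_(x <- zip s t) hform (stdvec x.1) (stdvec x.2).

Lemma mono_cat s t s' t' : size s = size t ->
  mono (s ++ s') (t ++ t') = mono s t * mono s' t'.
Proof. by move=> st; rewrite /mono zip_cat // big_cat. Qed.

Lemma mono_comm s t s' t' : GRing.comm (mono s t) (mono s' t').
Proof.
by apply: commr_prod => x _; apply/commr_sym/commr_prod => y _; apply: hform_comm.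
Qed.

Lemma mono_sqr0 x s : mono (x :: s) (x :: s) * mono (x :: s) (x :: s) = 0.
Proof.
have -> : mono (x :: s) (x :: s) = mono [:: x] [:: x] * mono s s by rewrite -mono_cat.
rewrite -mulrA [mono s s * _]mulrA (mono_comm s s [:: x] [:: x]) -mulrA mulrA.
by rewrite {1 2}/mono !big_seq1 hform_sqr0 mul0r.
Qed.

Lemma monoE s t : size s = size t ->
  mono s t = (\prod_(j < size s) ('i * (-1) ^+ j)) *:
    ((\prod_(x <- s) (form10 (stdvec x) : E)) * \prod_(x <- t) (form01conj (stdvec x) : E)).
Proof.
move=> st; have [s1 t1] : unzip1 (zip s t) = s /\ unzip2 (zip s t) = t.
  by rewrite unzip1_zip ?unzip2_zip ?st.
rewrite /mono (prod_pairs (@one_form_anti C n)) => [|x|x]; [|exact: one_form10|exact: one_form01].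
have -> : size (zip s t) = size s by rewrite size_zip st minnn.
rewrite -(big_map fst xpredT (fun k => form10 (stdvec k) : E)).
rewrite -(big_map snd xpredT (fun k => form01conj (stdvec k) : E)).
by rewrite -[map fst _]/(unzip1 _) -[map snd _]/(unzip2 _) s1 t1.
Qed.

(** The scalar from [monoE] depends only on the common length, so it is the same on both sides;
    sorting the two index lists separately yields the two signs. *)
Lemma mono_sort s t : size s = size t ->
  (let: (c, u) := sign_sort s in let: (d, v) := sign_sort t in
   (c * d == 0) || (u == iota 0 (size s)) && (v == iota 0 (size s))) ->
  mono s t = ((sign_sort s).1 * (sign_sort t).1)%:~R *:
    mono (iota 0 (size s)) (iota 0 (size s)).
Proof.
move=> st H; rewrite !monoE // size_iota.
rewrite (sign_sortE (@one_form_anti C n) (@one_form_sqr0 C n) s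
  (fun k => @one_form10 C n (stdvec k))).
rewrite (sign_sortE (@one_form_anti C n) (@one_form_sqr0 C n) t
  (fun k => @one_form01 C n (stdvec k))).
case: (sign_sort s) (sign_sort t) H => c u [d v] /=.
rewrite -scalerAl -scalerAr !scalerA -mulrA -intrM.
case: eqP => [-> _|_ /= /andP[/eqP-> /eqP->]]; first by rewrite !(mulr0z, mulr0, mul0r) !scale0r.
by rewrite mulrC.
Qed.

Lemma form10_stdvec (j : 'I_n) : form10 (stdvec j) = dz C j :> E.
Proof.
rewrite form10E (bigD1 j) //= big1 ?addr0 /stdvec ?eqxx ?scale1r // => k /negPf kj.
by rewrite (inj_eq val_inj) eq_sym kj scale0r.
Qed.

Lemma form01conj_stdvec (j : 'I_n) : form01conj (stdvec j) = dzb C j :> E.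
Proof.
rewrite form01conjE (bigD1 j) //= big1 ?addr0 /stdvec ?eqxx ?conjC1 ?scale1r // => k /negPf kj.
by rewrite (inj_eq val_inj) eq_sym kj conjC0 scale0r.
Qed.

Lemma zip_id (T : Type) (s : seq T) : zip s s = [seq (x, x) | x <- s].
Proof. by elim: s => //= x s ->. Qed.

Lemma dV_mono : dV C n = mono (iota 0 n) (iota 0 n) :> E.
Proof.
rewrite /mono zip_id big_map -[iota 0 n](_ : index_iota 0 n = _); last by rewrite /index_iota subn0.
rewrite big_mkord /dV.
transitivity (\prod_(j < n) ('i *: ((dz C j : E) * (dzb C j : E)))) => //.
by apply: eq_bigr => j _; rewrite /hform form10_stdvec form01conj_stdvec.
Qed.

(** The form for [p = 3], in the first six coordinates. *)
Definition core : E := \sum_(x <- herm_terms) x.1%:~R *: mono x.2.1 x.2.2.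

Lemma core_sqr : core * core = (- 36) *: mono (iota 0 6) (iota 0 6).
Proof.
transitivity ((\sum_(x <- herm_terms) \sum_(y <- herm_terms) x.1 * y.1 * pair_sign x y)%:~R *:
   mono (iota 0 6) (iota 0 6)); last first.
  by rewrite herm_terms_square intz rmorphN.
rewrite rmorph_sum scaler_suml /core mulr_suml big_seq [RHS]big_seq.
apply: eq_bigr => x xT; rewrite rmorph_sum scaler_suml mulr_sumr big_seq [RHS]big_seq.
apply: eq_bigr => y yT.
have /allP/(_ _ xT)/andP[/eqP x1 /eqP x2] := herm_terms_size.
have /allP/(_ _ yT)/andP[/eqP y1 /eqP y2] := herm_terms_size.
have /allP/(_ _ xT)/allP/(_ _ yT) := herm_terms_sorted.
move=> H; rewrite -scalerAl -scalerAr scalerA -mono_cat ?x1 ?x2 //.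
rewrite mono_sort ?size_cat ?x1 ?x2 ?y1 ?y2 //=; last first.
  move: H; rewrite /pair_sign.
  by case: (sign_sort (x.2.1 ++ _)) (sign_sort (x.2.2 ++ _)) => [c u] [d v].
by rewrite scalerA -!intrM.
Qed.

(** Each monomial squares to 0 and the two cross products agree, so [N = 2]. For [q = 0] both
    monomials are the empty product 1, so [b = 2] and [N = 4]. *)
Lemma tail_sqr k q : exists2 N : C, 0 < N &
  let b := mono (iota k q) (iota k q) + mono (iota (k + q) q) (iota (k + q) q) in
  b * b = N *: mono (iota k (q + q)) (iota k (q + q)).
Proof.
case: q => [|q].
  exists 4; first by rewrite ltr0n.
  rewrite /mono /= !big_nil mulrDl mul1r -!mulr2n -mulrnA.
  by rewrite scaler_nat.
exists 2; first by rewrite ltr0n.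
rewrite iotaD mono_cat //; cbv zeta; rewrite mulrDl !mulrDr /= !mono_sqr0 addr0 add0r.
by rewrite [X in _ + X](mono_comm _ _ _ _) scaler_nat mulr2n.
Qed.

Lemma core_mono_comm s : GRing.comm core (mono s s).
Proof.
apply/commr_sym/commr_sum => x _; rewrite /GRing.comm -scalerAr -scalerAl.
by rewrite mono_comm.
Qed.

Definition example q : E :=
  core * (mono (iota 6 q) (iota 6 q) + mono (iota (6 + q) q) (iota (6 + q) q)).

Lemma example_sqr q : n = (6 + (q + q))%N ->
  exists2 c : C, c < 0 & example q * example q = c *: (dV C n : E).
Proof.
move=> nE; have [N N0 bb] := tail_sqr 6 q; exists (- 36 * N).
  by rewrite nmulr_rlt0 // oppr_lt0 ltr0n.
rewrite /example; move: bb; set b := (_ + _) => /= bb.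
have cb : GRing.comm core b by apply: commrD; apply: core_mono_comm.
rewrite -mulrA [b * (core * b)]mulrA -cb -mulrA mulrA core_sqr bb.
rewrite -scalerAl -scalerAr scalerA dV_mono; congr (_ *: _).
have -> : iota 0 n = iota 0 6 ++ iota 6 (q + q) by rewrite nE iotaD.
by rewrite mono_cat.
Qed.

(** The product has [n] factors, so [prod_hform] turns it into determinants; positivity thus becomes
    an inequality between minors. *)
Lemma mono_mul_hforms (L : seq V) s t : size s = size t ->
  (size s + size L)%N = n ->
  mono s t * \prod_(u <- L) hform u u =
  (vecdet (map stdvec s ++ L) * (vecdet (map stdvec t ++ L))^*) *: (dV C n : E).
Proof.
move=> st sn.
pose X := zip (map stdvec s) (map stdvec t) ++ [seq (u, u) | u <- L].
have -> : mono s t * \prod_(u <- L) hform u u = \prod_(x <- X) hform x.1 x.2.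
  rewrite big_cat big_map /= /mono; congr (_ * _).
  suff -> : zip (map stdvec s) (map stdvec t) =
      [seq (stdvec x.1, stdvec x.2) | x <- zip s t] by rewrite big_map.
  by elim: s t {st sn X} => [|x s IH] [|y t] //=; rewrite IH.
rewrite prod_hform; last by rewrite size_cat size_zip !size_map -st minnn.
rewrite /X /unzip1 /unzip2 !map_cat -!map_comp.
rewrite -[map fst _]/(unzip1 _) -[map snd _]/(unzip2 _) unzip1_zip ?unzip2_zip ?size_map ?st //.
by rewrite !map_id.
Qed.

(** [L] is any list of [n - 3] vectors, so that it can hold basis vectors as well as test
    vectors. *)
Lemma core_mul_nonneg (L : seq V) : (size L + 3)%N = n ->
  exists2 c : C, 0 <= c & core * \prod_(u <- L) hform u u = c *: (dV C n : E).
Proof.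
move=> nE.
pose D s := vecdet (map stdvec s ++ L).
exists (\sum_(x <- herm_terms) x.1%:~R * (D x.2.1 * (D x.2.2)^*)).
  rewrite herm_terms_sum.
  under [X in _ + X]eq_bigr => i _ do under eq_bigr => j _ do rewrite !mul1r.
  apply: example_herm_ge0 => // i ir.
  (* The relation that exchanges the [i]-th index of [triP] with each index of [triQ]. *)
  rewrite /D (vecdet_exchange (i := i)) ?size_map //; last 2 first.
  - by rewrite addnC.
  - by move: ir; rewrite mem_iota.
  rewrite !big_ord_recl big_ord0 !big_cons big_nil.
  by move: ir; rewrite !inE => /or3P[]/eqP->.
rewrite mulr_suml scaler_suml big_seq [RHS]big_seq; apply: eq_bigr => x xT.
have /allP/(_ _ xT)/andP[/eqP x1 /eqP x2] := herm_terms_size.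
by rewrite -scalerAl mono_mul_hforms ?x1 ?x2 ?scalerA // addnC.
Qed.

Lemma example_positive q p : (q + 3)%N = p -> n = (p + p)%N ->
  positive_form p (example q).
Proof.
move=> pE nE gam; set G := \big[_/_]_(k < _) _.
have GE : G = \prod_(u <- [seq gam k | k <- index_enum 'I_(n - p)]) hform u u by rewrite big_map.
(* Each monomial of the second factor is itself a product of forms [hform u u] with basis vectors
   [u], so it joins the test vectors in [L]; the count is [q + p = n - 3]. *)
have pos k : exists2 c : C, 0 <= c &
    core * (mono (iota k q) (iota k q) * (G : E)) = c *: (dV C n : E).
  have [|c c0 cE] := @core_mul_nonneg
    (map stdvec (iota k q) ++ [seq gam k | k <- index_enum 'I_(n - p)]).
    rewrite size_cat !size_map size_iota -[index_enum _]enumT size_enum_ord; lia.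
  exists c => //; rewrite -cE big_cat GE; congr (_ * (_ * _)).
  by rewrite /mono zip_id !big_map.
have [c c0 cE] := pos 6; have [d d0 dE] := pos (6 + q)%N.
exists (c + d); split; first exact: addr_ge0.
transitivity (example q * (G : E)) => //.
by rewrite /example -mulrA mulrDl mulrDr cE dE -scalerDl.
Qed.

(** * Bidegree *)

Lemma is_pq_add p q (a b : E) : is_pq_form p q a -> is_pq_form p q b -> is_pq_form p q (a + b).
Proof.
move=> pa pb S; rewrite ffunE; have [a0|/pa //] := eqVneq ((a : cform C n) S) 0.
by rewrite a0 add0r => /pb.
Qed.

Lemma is_pq_scale p q c (a : E) : is_pq_form p q a -> is_pq_form p q (c *: a).
Proof.
by move=> pa S; rewrite ffunE /= mulf_eq0 negb_or => /andP[_ /pa].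
Qed.

Lemma is_pq_sum p q I (s : seq I) (P : pred I) (f : I -> E) :
  (forall i, P i -> is_pq_form p q (f i)) -> is_pq_form p q (\sum_(i <- s | P i) f i).
Proof.
move=> pf; apply: (big_ind (fun a : E => is_pq_form p q a)) => //.
- by move=> S; rewrite ffunE eqxx.
- exact: is_pq_add.
Qed.

Lemma is_pq_mul p q p' q' (a b : E) : is_pq_form p q a -> is_pq_form p' q' b ->
  is_pq_form (p + p') (q + q') (a * b).
Proof.
move=> pa pb U; rewrite [_ U]wedgeE => abU.
have [S [T [/andP[dST /eqP <-] /pa[<- <-] /pb[<- <-]]]] : exists S T : {set gen n},
    [/\ [disjoint S & T] && (S :|: T == U), (a : cform C n) S != 0 & (b : cform C n) T != 0].
  (* If no pair contributed, every term of the coefficient at [U] would vanish. *)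
  apply: contrapT => nST; move/eqP: abU; apply; apply: big1 => S _; apply: big1 => T _.
  case: (boolP (_ && _)) => // dST; rewrite mulr1n.
  have [->|aS] := eqVneq ((a : cform C n) S) 0; first by rewrite mulr0 mul0r.
  have [->|bT] := eqVneq ((b : cform C n) T) 0; first by rewrite mulr0.
  by case: nST; exists S, T.
have card_add (f : 'I_n -> gen n) : #|[set j | f j \in S :|: T]| =
    (#|[set j | f j \in S]| + #|[set j | f j \in T]|)%N.
  rewrite -cardsUI [X in (_ = _ + X)%N]eq_card0 ?addn0.
    by apply: eq_card => j; rewrite !inE.
  by move=> j; rewrite !inE; apply/negP => /andP[/(disjointFr dST) ->].
by rewrite !card_add.
Qed.

Lemma is_pq_dz (j : 'I_n) : is_pq_form 1 0 (dz C j).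
Proof.
move=> S; rewrite ffunE; case: (altP (S =P _)) => [-> _|]; last by rewrite eqxx.
split.
  by rewrite -[RHS](cards1 j); apply: eq_card => k; rewrite !inE (inj_eq (@lshift_inj _ _)).
by apply: eq_card0 => k; rewrite !inE eq_rlshift.
Qed.

Lemma is_pq_dzb (j : 'I_n) : is_pq_form 0 1 (dzb C j).
Proof.
move=> S; rewrite ffunE; case: (altP (S =P _)) => [-> _|]; last by rewrite eqxx.
split; first by apply: eq_card0 => k; rewrite !inE eq_lrshift.
by rewrite -[RHS](cards1 j); apply: eq_card => k; rewrite !inE (inj_eq (@rshift_inj _ _)).
Qed.

Lemma is_pq_hform u v : is_pq_form 1 1 (hform u v : E).
Proof.
apply: is_pq_scale; apply: (@is_pq_mul 1 0 0 1).
  by rewrite form10E; apply: is_pq_sum => j _; apply/is_pq_scale/is_pq_dz.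
by rewrite form01conjE; apply: is_pq_sum => j _; apply/is_pq_scale/is_pq_dzb.
Qed.

Lemma is_pq_mono s t k : size s = k -> size t = k -> is_pq_form k k (mono s t).
Proof.
elim: s t k => [|x s IH] [|y t] [|k] //=.
  move=> _ _ S; rewrite /mono big_nil ffunE; case: (altP (S =P _)) => [-> _|]; last by rewrite eqxx.
  by split; apply: eq_card0 => j; rewrite !inE.
move=> [sk] [tk]; rewrite /mono /= big_cons -add1n; apply: is_pq_mul; last exact: IH.
exact: is_pq_hform.
Qed.

Lemma is_pq_example q : is_pq_form (3 + q) (3 + q) (example q).
Proof.
apply: is_pq_mul.
  rewrite /core big_seq; apply: is_pq_sum => x xT; apply: is_pq_scale.
  by have /allP/(_ _ xT)/andP[/eqP x1 /eqP x2] := herm_terms_size; apply: is_pq_mono.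
by apply: is_pq_add; apply: is_pq_mono; rewrite size_iota.
Qed.
End Example.

(* R : realType is the field of real numbers, R[i] = complex R is C. *)
Theorem theorem2 (R : realType) (p : nat) : (3 <= p)%N ->
  exists alpha : cform R[i] (2 * p),
    is_pq_form p p alpha /\ positive_form p alpha /\
    exists c : R[i], c < 0 /\ wedge alpha alpha = fscale c (dV R[i] (2 * p)).
Proof.
move=> p3; have [q pE] : exists q, p = (3 + q)%N by exists (p - 3)%N; rewrite subnKC.
exists (example R[i] (2 * p) q); split; first by have := @is_pq_example R[i] (2 * p) q; rewrite -pE.
split; first by apply: example_positive; lia.
have [|c c0 cE] := @example_sqr R[i] (2 * p) q; first by lia.
by exists c.
Qed.
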